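(* Let $\mathcal{M}$ be an acyclic oriented matroid on a finite ground set $S$ and let $(\mathcal{F},\mathcal{M})$ be a connected facial building set. Then the facial nested complex of $(\mathcal{F},\mathcal{M})$, ordered by inclusion, coincides with the face semilattice $\mathcal{L}(\mathrm{sd}(\mathcal{F},\mathcal{M}))_{<\hat 1}$ of the oriented matroid $\mathrm{sd}(\mathcal{F},\mathcal{M})$ obtained from $\mathcal{M}$ by iterated stellar subdivisions at the elements of $\mathcal{F}\setminus\{S\}$.
   Context: An oriented matroid $\mathcal{M}$ on $S$ is acyclic if $(S,\varnothing)$ is a covector. A face of an acyclic $\mathcal{M}$ is a set $F\subseteq S$ such that $(S\setminus F,\varnothing)$ is a covector. The faces ordered by inclusion form the Las Vergnas face lattice $\mathcal{L}(\mathcal{M})$, with bottom $\varnothing$ and top $\hat1=S$; the face semilattice is $\mathcal{L}(\mathcal{M})_{<\hat 1}$ (by convention $\{\varnothing\}$ if the ground set is empty). For a finite lattice $\mathcal{L}$, an $\mathcal{L}$-building set is a subset $\mathcal{F}\subseteq\mathcal{L}_{>\hat 0}$ such that for every $Y\in\mathcal{L}_{>\hat 0}$, with $\{B_1,\dots,B_k\}=\max(\mathcal{F}_{\le Y})$, there is a poset isomorphism $\prod_{j}\mathcal{L}_{\le B_j}\to\mathcal{L}_{\le Y}$ whose $j$-th component is the inclusion. Let $\kappa(\mathcal{F})=\max(\mathcal{F})$; $\mathcal{F}$ is connected if $|\kappa(\mathcal{F})|=1$. An $\mathcal{L}$-nested set on $\mathcal{F}$ is a subset $\mathcal{N}\subseteq\mathcal{F}$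 containing $\kappa(\mathcal{F})$ such that for any $k\ge2$ pairwise incomparable $B_1,\dots,B_k\in\mathcal{N}\setminus\kappa(\mathcal{F})$, the join $B_1\vee\cdots\vee B_k$ is not in $\mathcal{F}$. The $\mathcal{L}$-nested complex of $\mathcal{F}$ is the simplicial complex with faces $\mathcal{N}\setminus\kappa(\mathcal{F})$. A facial building set is a pair $(\mathcal{F},\mathcal{M})$ with $\mathcal{F}$ an $\mathcal{L}(\mathcal{M})$-building set; its facial nested complex is the $\mathcal{L}(\mathcal{M})$-nested complex of $\mathcal{F}$. If $\mathcal{F}$ is connected then $\kappa(\mathcal{F})=\{S\}$. Stellar subdivision: for an acyclic oriented matroid $\mathcal{M}$ on $S$ and a proper face $F$, a stellar subdivision $\mathrm{sd}(F,\mathcal{M})$ is any acyclic oriented matroid on $S\cup\{a_F\}$ ($a_F$ a new element) whose proper faces are exactly (i) the proper faces $G$ of $\mathcal{M}$ with $G\not\supseteq F$, and (ii) the sets $\{a_F\}\cup G$ where $G$ is a proper face of $\mathcal{M}$ with $G\not\supseteq F$ such that some proper face of $\mathcal{M}$ contains $F\cup G$. Such an oriented matroid always exists; it is not unique, but its face semilattice is. For a connected facial building set, define $\mathrm{sd}(\mathcal{F},\mathcal{M})$ as the restriction of $\mathrm{sd}(F_1,\mathrm{sd}(F_2,\dots\mathrm{sd}(F_m,\mathcal{M})\dots))$ to the set of new elements $\{a_{F}: F\in\mathcal{F}\setminus\{S\}\}$, where $F_1,\dots,F_m$ are the elements of $\mathcal{F}\setminus\{S\}$ ordered in any way such that $F_i\subseteq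 F_j$ implies $i\le j$ (so larger faces are subdivided first), and where $a_F$ is relabeled by $F$. *)

(* Defs.v *)
From HB Require Import structures.
From mathcomp Require Import all_boot all_order.

Set Implicit Arguments.
Unset Strict Implicit.
Unset Printing Implicit Defensive.

Import Order.TTheory.

(** * Oriented matroids, given by their covectors *)

Section SignedSets.
Variable U : finType.

(* A sign vector is a pair (positive part, negative part); the sign is 0
   elsewhere. *)
Definition signed_set := ({set U} * {set U})%type.

Implicit Types X Y : signed_set.

Definition sopp X : signed_set := (X.2, X.1).

Definition scomp X Y : signed_set :=
  (X.1 :|: (Y.1 :\: X.2), X.2 :|: (Y.2 :\: X.1)).

Definition separation X Y : {set U} := (X.1 :&: Y.2) :|: (X.2 :&: Y.1).

(* The ground set is a subset of an ambient finite type U, so that new elements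
   can be adjoined without changing the type.
   The last field is covector elimination: Z vanishes at e and agrees with
   X o Y outside the separation set of X and Y. *)
Record oriented_matroid := OrientedMatroid {
  ground : {set U};
  covectors : {set signed_set};
  covector_signed : forall X, X \in covectors ->
    [disjoint X.1 & X.2] /\ X.1 :|: X.2 \subset ground;
  covector0 : (set0, set0) \in covectors;
  covectorN : forall X, X \in covectors -> sopp X \in covectors;
  covector_comp : forall X Y, X \in covectors -> Y \in covectors ->
    scomp X Y \in covectors;
  covector_elim : forall X Y e, X \in covectors -> Y \in covectors ->
    e \in separation X Y ->
    exists Z, [/\ Z \in covectors, e \notin Z.1 :|: Z.2,
      Z.1 :\: separation X Y = (scomp X Y).1 :\: separation X Y &
      Z.2 :\: separation X Y = (scomp X Y).2 :\: separation X Y]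
}.

Definition acyclic (M : oriented_matroid) : bool :=
  (ground M, set0) \in covectors M.

Record acyclic_om := AcyclicOM {
  om_of_acyclic :> oriented_matroid;
  acyclic_omP : acyclic om_of_acyclic
}.

Definition is_face (M : oriented_matroid) (F : {set U}) : bool :=
  (F \subset ground M) && ((ground M :\: F, set0) \in covectors M).

Definition proper_face (M : oriented_matroid) (F : {set U}) : bool :=
  is_face M F && (F != ground M).

End SignedSets.

(** * The Las Vergnas face lattice *)

Record face (U : finType) (M : acyclic_om U) := Face {
  face_set :> {set U};
  faceP : is_face M face_set
}.

HB.instance Definition _ (U : finType) (M : acyclic_om U) :=
  [isSub for @face_set U M].
HB.instance Definition _ (U : finType) (M : acyclic_om U) :=
  [Finite of face M by <:].

Fact face_display : Order.disp_t. Proof. exact: Order.Disp tt tt. Qed.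

Section FaceLattice.
Variables (U : finType) (M : acyclic_om U).
Implicit Types F G H : face M.

Lemma is_face0 : is_face M set0.
Proof. by rewrite /is_face sub0set setD0; apply: acyclic_omP. Qed.

Lemma is_faceT : is_face M (ground M).
Proof. by rewrite /is_face subxx setDv; apply: covector0. Qed.

Lemma is_faceI (A B : {set U}) :
  is_face M A -> is_face M B -> is_face M (A :&: B).
Proof.
case/andP=> sA cA /andP[sB cB]; apply/andP; split.
  by rewrite subIset ?sA.
have := covector_comp cA cB; rewrite /scomp /= setD0 set0D setU0.
by rewrite -setDIr.
Qed.

Lemma is_face_bigcap (P : pred {set U}) : {in P, forall A, is_face M A} ->
  is_face M (ground M :&: \bigcap_(A | P A) A).
Proof.
move=> facesP; apply: (big_rec (fun B => is_face M (ground M :&: B))).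
  by rewrite setIT; apply: is_faceT.
by move=> A B PA IH; rewrite setICA; apply: is_faceI; first exact: facesP.
Qed.

Definition face_bot : face M := Face is_face0.
Definition face_top : face M := Face is_faceT.
Definition face_meet F G : face M := Face (is_faceI (faceP F) (faceP G)).

Definition upper_bounds_pred F G : pred {set U} :=
  [pred A : {set U} | is_face M A & (F \subset A) && (G \subset A)].

Lemma upper_bounds_face F G :
  {in upper_bounds_pred F G, forall A, is_face M A}.
Proof. by move=> A /andP[]. Qed.

(* The join is the smallest face containing both. *)
Definition face_join F G : face M :=
  Face (is_face_bigcap (@upper_bounds_face F G)).

Definition face_le F G : bool := F \subset G.

Lemma face_le_refl : reflexive face_le.
Proof. by move=> F; apply: subxx. Qed.

Lemma face_le_anti : antisymmetric face_le.
Proof. by move=> F G; rewrite -eqEsubset => /eqP/val_inj. Qed.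

Lemma face_le_trans : transitive face_le.
Proof. by move=> G F H; apply: subset_trans. Qed.

HB.instance Definition _ := Order.Le_isPOrder.Build face_display (face M)
  face_le_refl face_le_anti face_le_trans.

Lemma face_lexI F G H :
  (F <= face_meet G H)%O = (F <= G)%O && (F <= H)%O.
Proof. exact: subsetI. Qed.

Lemma face_leUx F G H :
  (face_join F G <= H)%O = (F <= H)%O && (G <= H)%O.
Proof.
apply/idP/andP => [sJH|[sFH sGH]].
  split; apply: subset_trans sJH; rewrite subsetI;
    (apply/andP; split; first by case/andP: (faceP F); case/andP: (faceP G));
    by apply/bigcapsP => A /and3P[].
apply: subset_trans (subsetIr _ _) _.
by apply: bigcap_inf; apply/andP; split; [exact: faceP | exact/andP].
Qed.

HB.instance Definition _ :=
  Order.POrder_isMeetSemilattice.Build face_display (face M) face_lexI.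
HB.instance Definition _ :=
  Order.POrder_isJoinSemilattice.Build face_display (face M) face_leUx.

Lemma face_le0x F : (face_bot <= F)%O.
Proof. exact: sub0set. Qed.

Lemma face_lex1 F : (F <= face_top)%O.
Proof. by case/andP: (faceP F). Qed.

HB.instance Definition _ :=
  Order.hasBottom.Build face_display (face M) face_le0x.
HB.instance Definition _ :=
  Order.hasTop.Build face_display (face M) face_lex1.

(* By convention this is {set0} for the empty ground set, where set0 is not
   a proper face. *)
Definition face_semilattice : {set {set U}} :=
  if ground M == set0 then [set set0] else [set F | proper_face M F].

End FaceLattice.

(** * Building sets and nested sets of a finite lattice *)

Section Building.
Variables (d : Order.disp_t) (L : finTBLatticeType d).
Implicit Types (F N A : {set L}) (Y : L).
Local Open Scope order_scope.

Definition maxima A : {set L} :=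
  [set x in A | [forall y in A, (x <= y) ==> (y == x)]].

Definition below Y : finType := {x : L | x <= Y}.
Definition below_bot Y : below Y := exist _ \bot (le0x Y).

Definition factors F Y : finType :=
  {B : L | B \in maxima [set x in F | x <= Y]}.

Definition factor_prod F Y : finType :=
  {dffun forall B : factors F Y, below (val B)}.

(* dfwith puts x in coordinate B and the bottom in all other coordinates. *)
Definition factor_incl F Y (B : factors F Y) (x : below (val B)) :
    factor_prod F Y :=
  finfun (dfwith (fun C : factors F Y => below_bot (val C)) x).

Definition building_set F : Prop :=
  \bot \notin F /\
  forall Y, \bot < Y ->
    exists phi : factor_prod F Y -> below Y,
      [/\ bijective phi,
          forall f g, (val (phi f) <= val (phi g)) =
                      [forall B, val (f B) <= val (g B)]
        & forall (B : factors F Y) (x : below (val B)),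
            val (phi (factor_incl x)) = val x].

Definition kappa F : {set L} := maxima F.

Definition connected F : bool := #|kappa F| == 1%N.

Definition nested_set F N : bool :=
  [&& N \subset F, kappa F \subset N &
      [forall A : {set L},
        [&& A \subset N :\: kappa F, (1 < #|A|)%N &
            [forall x in A, forall y in A, (x != y) ==> (x >< y)]] ==>
        (\join_(x in A) x \notin F)]].

Definition nested_complex F : {set {set L}} :=
  [set N :\: kappa F | N in [set N : {set L} | nested_set F N]].

End Building.

(** * Stellar subdivisions *)

Section Restriction.
Variables (U V : finType) (a : V -> U) (D : {set V}).

Definition pull_set (A : {set U}) : {set V} := D :&: a @^-1: A.

Definition pull_signed (X : signed_set U) : signed_set V :=
  (pull_set X.1, pull_set X.2).

Lemma pull_comp X Y :
  pull_signed (scomp X Y) = scomp (pull_signed X) (pull_signed Y).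
Proof.
by congr (_, _); apply/setP=> x; rewrite !inE /=; case: (x \in D).
Qed.

Lemma pull_separation X Y :
  separation (pull_signed X) (pull_signed Y) = pull_set (separation X Y).
Proof. by apply/setP=> x; rewrite !inE /=; case: (x \in D). Qed.

Variable M : oriented_matroid U.

Let ground' := pull_set (ground M).
Let covectors' := [set pull_signed X | X in covectors M].

Fact restrict_signed X : X \in covectors' ->
  [disjoint X.1 & X.2] /\ X.1 :|: X.2 \subset ground'.
Proof.
case/imsetP=> Z /covector_signed[disZ subZ] ->; split.
  rewrite -setI_eq0; apply/eqP/setP=> x; rewrite !inE /=.
  have /setP/(_ (a x)) : Z.1 :&: Z.2 = set0.
    by apply/eqP; rewrite setI_eq0.
  by rewrite !inE; case: (x \in D) => //= ->.
rewrite -setIUr -preimsetU; exact: setIS (preimsetS _ subZ).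
Qed.

Fact restrict0 : (set0, set0) \in covectors'.
Proof.
apply/imsetP; exists (set0, set0); first exact: covector0.
by rewrite /pull_signed /pull_set /= preimset0 setI0.
Qed.

Fact restrictN X : X \in covectors' -> sopp X \in covectors'.
Proof.
case/imsetP=> Z ZM ->; apply/imsetP; exists (sopp Z) => //.
exact: covectorN.
Qed.

Fact restrict_comp X Y : X \in covectors' -> Y \in covectors' ->
  scomp X Y \in covectors'.
Proof.
case/imsetP=> X0 XM -> /imsetP[Y0 YM ->].
by rewrite -pull_comp imset_f ?covector_comp.
Qed.

Fact restrict_elim X Y e : X \in covectors' -> Y \in covectors' ->
  e \in separation X Y ->
  exists Z, [/\ Z \in covectors', e \notin Z.1 :|: Z.2,
    Z.1 :\: separation X Y = (scomp X Y).1 :\: separation X Y &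
    Z.2 :\: separation X Y = (scomp X Y).2 :\: separation X Y].
Proof.
case/imsetP=> X0 XM -> /imsetP[Y0 YM ->]; rewrite pull_separation -pull_comp.
rewrite inE => /andP[_]; rewrite inE => /(covector_elim XM YM).
case=> Z [ZM eZ Z1 Z2]; exists (pull_signed Z).
have pullD A B : pull_set A :\: pull_set B = pull_set (A :\: B).
  by apply/setP=> x; rewrite !inE; case: (x \in D).
split; first exact: imset_f.
- by apply: contra eZ; rewrite !inE -andb_orr => /andP[].
- by rewrite !pullD Z1.
- by rewrite !pullD Z2.
Qed.

(* The restriction of M to a(D), with the element a(x) renamed x.  It is used
   for a injective on D with a(D) contained in the ground set of M; then its
   ground set is D. *)
Definition restrict_om : oriented_matroid V :=
  OrientedMatroid restrict_signed restrict0 restrictN restrict_comp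
    restrict_elim.

Fact restrict_acyclic : acyclic M -> acyclic restrict_om.
Proof.
move=> acM; apply/imsetP; exists (ground M, set0) => //.
by rewrite /pull_signed /pull_set /= preimset0 setI0.
Qed.

End Restriction.

Definition restrict (U V : finType) (a : V -> U) (D : {set V})
    (M : acyclic_om U) : acyclic_om V :=
  AcyclicOM (restrict_acyclic a D (acyclic_omP M)).

Section Stellar.
Variable U : finType.

(* M' is a stellar subdivision sd(F, M) with new element aF.  It is a relation,
   as only the face semilattice of M' is determined by M and F. *)
Definition stellar (M : acyclic_om U) (F : {set U}) (aF : U)
    (M' : acyclic_om U) : Prop :=
  [/\ proper_face M F,
      aF \notin ground M,
      ground M' = aF |: ground M
    & forall H : {set U}, proper_face M' H <->
        (proper_face M H /\ ~~ (F \subset H)) \/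
        (exists G : {set U},
          [/\ proper_face M G, ~~ (F \subset G),
              exists2 K : {set U}, proper_face M K & F :|: G \subset K
            & H = aF |: G])].

(* M' is an instance of sd(F_1, sd(F_2, ... sd(F_m, M) ...)) for
   s = [:: F_1; ...; F_m], the new element for F_i being a F_i. *)
Fixpoint iterated_stellar (M : acyclic_om U) (a : face M -> U)
    (s : seq (face M)) (M' : acyclic_om U) : Prop :=
  if s is F :: s' then
    exists2 M1, iterated_stellar a s' M1 & stellar M1 F (a F) M'
  else M' = M.

(* N is an instance of sd(F, M).  The new element a G is relabeled by G, so the
   ground set of N is F :\ \top and its elements are faces of M.  The conditions
   on new elements in stellar force a to be injective on F :\ \top. *)
Definition facial_sd (M : acyclic_om U) (F : {set face M})
    (N : acyclic_om (face M)) : Prop :=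
  exists (a : face M -> U) (s : seq (face M)) (M' : acyclic_om U),
    [/\ perm_eq s (enum (F :\ \top%O)),
        {in s &, forall G H : face M,
          G \subset H -> (index G s <= index H s)%N},
        iterated_stellar a s M'
      & N = restrict a (F :\ \top%O) M'].

End Stellar.

(* Main.v *)
Require Import Defs.
From HB Require Import structures.
From mathcomp Require Import all_boot all_order.

Set Implicit Arguments.
Unset Strict Implicit.
Unset Printing Implicit Defensive.

Import Order.TTheory.

(** Write D for the building set without the top, s for the chosen order on D
    and M' for the iterated subdivision.  The proof has three ingredients.

    Subdivision.  Unfolding the stellar steps, the proper faces of M' are the
    sets a(B) u G, with B a set of subdivided faces and G a face of M, such that
    no E in s and not even the top lies below the join of G with the elements
    of B that precede E in s ([blowup_face], [proper_face_iterated]).  Indeed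
    subdividing at E removes the faces above E, and adjoining a_E to a face
    requires that the face joined with E survives the earlier subdivisions.
    Every nonzero lattice element lies above an element of the building set,
    so G must be empty: the proper faces of M' contain new elements only.

    Nested sets.  It remains to compare the condition on B with nestedness
    ([mem_nested_complex]).  If an antichain in B with at least two elements
    had its join E in the building set, then all its members would be strictly
    below E, hence precede E, against the condition.  Conversely, suppose that
    B is nested and that E lies below the join Y of elements of B preceding E.
    The maximal ones among these form an antichain with join Y.  The interval
    below Y is the product of the intervals below the factors of Y, and the
    members of the antichain are distributed among the factors; the join of the
    members below one factor must be the whole factor.  By nestedness every
    factor then is itself a member of the antichain ([le_join_nested]), so E
    lies below an element preceding it, contrary to the order.

    Restriction.  A covector of M' that is nonnegative on the new elements need
    not a priori be nonnegative on M'.  But walking from the positive covector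
    towards X one meets a nonempty face of M' contained in the negative part of
    X ([face_below_negative]).  As all proper faces of M' consist of new
    elements, a covector nonnegative on the new elements is nonnegative, and
    restricting to them does not change the proper faces
    ([proper_face_restrict]). *)

(** * Building sets and their factors *)

Section Maxima.
Variables (d : Order.disp_t) (L : finTBLatticeType d).
Implicit Types (A F N : {set L}) (x y Y Z E : L).
Local Open Scope order_scope.

Lemma maximaP A x :
  reflect (x \in A /\ {in A, forall y, x <= y -> y = x}) (x \in maxima A).
Proof.
rewrite inE; apply: (iffP andP) => [[xA /forall_inP mx]|[xA mx]]; split=> //.
  by move=> y /mx /implyP h /h /eqP.
by apply/forall_inP=> y yA; apply/implyP=> /(mx _ yA) ->.
Qed.

Lemma maxima_above A x : x \in A -> exists2 m, m \in maxima A & x <= m.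
Proof.
move=> xA; pose P y := (y \in A) && (x <= y).
have Px : P x by rewrite /P xA lexx.
case: (arg_maxnP (fun y => #|[set z | z <= y]|) Px) => m /andP[mA xm] mx.
exists m => //; apply/maximaP; split=> // y yA my.
have /subset_leqif_cards[_ eqC] : [set z | z <= m] \subset [set z | z <= y].
  by apply/subsetP=> z; rewrite !inE => /le_trans; apply.
have Py : P y by rewrite /P yA (le_trans xm my).
have /setP/(_ y) : [set z | z <= m] = [set z | z <= y].
  apply/eqP; rewrite -eqC eqn_leq; apply/andP; split; last exact: mx.
  by apply/subset_leq_card/subsetP=> z; rewrite !inE => /le_trans; apply.
by rewrite !inE lexx => ym; apply: le_anti; rewrite ym my.
Qed.

Lemma join_maxima A : \join_(x in maxima A) x = \join_(x in A) x.
Proof.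
apply: le_anti; apply/andP; split; apply/joinsP => x.
  by case/maximaP=> xA _; apply: joins_sup.
by case/maxima_above=> m mA xm; apply: le_trans xm _; apply: joins_sup.
Qed.

Section BuildingSet.
Variable F : {set L}.
Hypothesis buildF : building_set F.

Local Notation factor Y := (maxima [set x in F | x <= Y]).

Lemma building_neq0 x : x \in F -> x != \bot.
Proof. by case: buildF => b0 _ xF; apply: contraNneq b0 => <-. Qed.

Lemma factorP Y B : B \in factor Y -> B \in F /\ B <= Y.
Proof. by case/maximaP; rewrite inE => /andP[]. Qed.

Lemma factor_above Y x :
  x \in F -> x <= Y -> exists2 B, B \in factor Y & x <= B.
Proof. by move=> xF xY; apply: maxima_above; rewrite inE xF. Qed.

(** If Z bounds all factors then the element of the product corresponding to the
    meet of Y and Z is maximal in each coordinate, as is seen by comparing it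
    with the factors themselves; hence Y <= Z. *)
Lemma join_factors Y : \join_(B in factor Y) B = Y.
Proof.
apply: le_anti; apply/andP; split.
  by apply/joinsP=> B /factorP[].
have [->|Y0] := eqVneq Y \bot; first exact: le0x.
set Z := \join_(B in _) B.
have [_ /(_ Y)] := buildF; rewrite lt0x => /(_ Y0) [phi [[psi psiK phiK] mono incl]].
have ZY : Y `&` Z <= Y by apply: leIl.
have YY : Y <= Y by [].
have : psi (exist _ Y YY) = psi (exist _ Y YY) by [].
have /(_ (psi (exist _ (Y `&` Z) ZY))) := mono (psi (exist _ Y YY)).
rewrite !phiK /= lexI lexx /= => -> _.
apply/forallP=> B.
have BB : val B <= val B by [].
apply: le_trans (valP (psi (exist _ Y YY) B)) _.
have := mono (factor_incl (exist _ (val B) BB)) (psi (exist _ (Y `&` Z) ZY)).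
rewrite incl phiK /= lexI.
have BZ : val B <= Z by apply: joins_sup (valP B).
have [_ ->] := factorP (valP B); rewrite BZ.
by move/esym/forallP/(_ B); rewrite /factor_incl ffunE dfwith_in.
Qed.

(** The tuple of the y B is sent to an upper bound of all the y B below Y, hence
    to Y itself, the image of the tuple of all the factors. *)
Lemma factors_rigid Y (y : L -> L) : {in factor Y, forall B, y B <= B} ->
  Y <= \join_(B in factor Y) y B -> {in factor Y, forall B, y B = B}.
Proof.
move=> yB Yy B fB; apply: le_anti; rewrite yB //=.
have [BF BY] := factorP fB.
have Y0 : \bot < Y.
  by rewrite (lt_le_trans _ BY) // lt0x building_neq0.
have [_ /(_ Y Y0) [phi [[psi psiK phiK] mono incl]]] := buildF.
pose f : factor_prod F Y :=
  [ffun C : factors F Y => exist (fun x => x <= val C) (y (val C)) (yB _ (valP C))].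
have YY : Y <= Y by [].
have BB : B <= B by [].
pose b : factors F Y := exist _ B fB.
have le_f : Y <= val (phi f).
  apply: le_trans Yy _; apply/joinsP=> C fC.
  pose c : factors F Y := exist _ C fC.
  have := mono (factor_incl (B := c) (exist _ (y C) (yB _ fC))) f.
  rewrite incl /= => ->; apply/forallP=> D; rewrite /factor_incl !ffunE /=.
  by case: dfwithP => [|E cE] //=; apply: le0x.
have := mono (factor_incl (B := b) (exist _ B BB)) f.
rewrite incl /= (le_trans BY le_f) => /esym/forallP/(_ b).
by rewrite /factor_incl !ffunE dfwith_in.
Qed.

Lemma building_below Y : Y != \bot -> exists2 x, x \in F & x <= Y.
Proof.
have [E0 /eqP[]|[B fB] _] := set_0Vmem (factor Y).
  by rewrite -(join_factors Y) E0 big_set0.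
by have [BF BY] := factorP fB; exists B.
Qed.

(** The join of the factors of the top is the top, and there is only one factor,
    so that factor is the top. *)
Lemma kappa_connected : connected F -> kappa F = [set \top].
Proof.
case/cards1P=> B kB; have eqF : factor \top = [set B].
  rewrite -kB; congr maxima; apply/setP=> x; by rewrite inE lex1 andbT.
by rewrite kB -(join_factors \top) eqF big_set1.
Qed.

(** Every factor B of the join of A is the join of the members of A below B, by
    [factors_rigid]; since B is in F there is just one such member, so B is in
    A.  As E lies below some factor, it lies below a member of A. *)
Lemma le_join_nested A E : A \subset F ->
    (forall A', A' \subset A -> (1 < #|A'|)%N -> \join_(x in A') x \notin F) ->
  E \in F -> E <= \join_(x in A) x -> exists2 x, x \in A & E <= x.
Proof.
move=> /subsetP sAF nA EF EY; set Y := \join_(x in A) x in EY.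
pose A_ B := [set x in A | x <= B].
have joinA_ : {in factor Y, forall B, \join_(x in A_ B) x = B}.
  apply: factors_rigid => [B _|].
    by apply/joinsP=> x; rewrite inE => /andP[].
  apply/joinsP=> x xA; have xY : x <= Y by apply: joins_sup.
  have [B fB xB] := factor_above (sAF _ xA) xY.
  have xA_ : x <= \join_(z in A_ B) z by apply: joins_sup; rewrite inE xA.
  by apply: le_trans xA_ _; apply: (joins_sup (fun C => \join_(z in A_ C) z)).
have [B fB EB] := factor_above EF EY; have [BF _] := factorP fB.
have sA_ : A_ B \subset A by apply/subsetP=> x; rewrite inE => /andP[].
have := nA _ sA_; rewrite joinA_ // BF.
have := joinA_ _ fB; case: (ltngtP #|A_ B| 1) => [||/eqP/cards1P[x Ax]].
- rewrite ltnS leqn0 cards_eq0 => /eqP ->; rewrite big_set0 => B0.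
  by have := building_neq0 BF; rewrite -B0 eqxx.
- by move=> _ _ /(_ isT).
rewrite Ax big_set1 => xB _; exists x; last by rewrite xB.
by apply: (subsetP sA_); rewrite Ax inE.
Qed.

End BuildingSet.

(** * The condition defining the faces of the iterated subdivision *)

(** When N is contained in s, this says that a(N) u Y is a proper face after the
    subdivisions at the elements of s, the last element of s being subdivided
    first.  The top is put behind s as an element that has been removed from the
    outset, so the case E = \top says that Y joined with all of N is proper. *)
Definition blowup_face (s : seq L) N Y :=
  all (fun E => ~~ (E <= Y `|` \join_(x in N | (index x s < index E s)%N) x))
    (rcons s \top).

Lemma blowup_face_nil N Y : blowup_face [::] N Y = (Y != \top).
Proof.
rewrite /blowup_face /= big_pred0 => [|x]; last by rewrite andbF.
by rewrite joinx0 andbT le1x.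
Qed.

(** The element E is subdivided last, so it precedes all others: when E is in N,
    it contributes to every join but the one tested against E itself. *)
Lemma blowup_face_cons E s N Y : uniq (E :: s) -> \top \notin E :: s ->
  blowup_face (E :: s) N Y =
  ~~ (E <= Y) && blowup_face s N (if E \in N then E `|` Y else Y).
Proof.
move=> /= /andP[Es us]; rewrite inE negb_or => /andP[ET Ts].
rewrite {1}/blowup_face /= big_pred0 => [|x]; last by rewrite eqxx ltn0 andbF.
rewrite joinx0; congr (_ && _); apply: eq_in_all => C.
rewrite mem_rcons inE => Cs.
have CE : E != C.
  by case/orP: Cs => [/eqP ->|Cs]; [rewrite eq_sym|apply: contraNneq Es => ->].
rewrite (negPf CE); congr (~~ (_ <= _)).
have idxE : (index E s < index C s)%N = false.
  by rewrite ltnNge (memNindex Es) index_size.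
case: ifP => EN.
  rewrite (bigD1 E) /=; last by rewrite EN eqxx.
  rewrite joinA [Y `|` E]joinC; congr (_ `|` _); apply: eq_bigl => x.
  by rewrite [E == x]eq_sym; case: eqP => [->|]; rewrite ?idxE ?andbF ?andbT.
congr (_ `|` _); apply: eq_bigl => x.
by case: eqP => [<-|//]; rewrite EN.
Qed.

Lemma blowup_face_le s N N' Y Y' :
    N :&: [set x in s] \subset N' -> Y <= Y' ->
  blowup_face s N' Y' -> blowup_face s N Y.
Proof.
move=> /subsetP sN YY; apply: sub_all => E; apply: contra => /le_trans; apply.
apply: leU2 => //; apply/joinsP=> x /andP[xN xE].
apply: joins_sup; rewrite xE sN // !inE xN -index_mem.
exact: leq_trans xE (index_size _ _).
Qed.

(** * Nested sets *)

Section NestedComplex.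
Variables (F : {set L}) (s : seq L).
Hypotheses (buildF : building_set F) (connF : connected F).
Hypothesis perm_s : perm_eq s (enum (F :\ \top)).
Hypothesis sorted_s :
  {in s &, forall x y, x <= y -> (index x s <= index y s)%N}.

Lemma mem_order x : (x \in s) = (x \in F :\ \top).
Proof. by rewrite (perm_mem perm_s) mem_enum. Qed.

Lemma top_notin_order : \top \notin s.
Proof. by rewrite mem_order !inE eqxx. Qed.

Lemma top_building : \top \in F.
Proof.
have /setP/(_ \top) := kappa_connected buildF connF.
by rewrite [in RHS]inE eqxx => /maximaP[].
Qed.

(** This extends the order on s to the top: not being in s, it has index size s,
    after everything else. *)
Lemma order_le x y : x \in F -> y \in F -> x <= y -> (index x s <= index y s)%N.
Proof.
move=> xF yF xy; have [->|yT] := eqVneq y \top.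
  by rewrite (memNindex top_notin_order) index_size.
have xT : x != \top by apply: contraNneq yT => xT; rewrite -le1x -xT.
by apply: sorted_s; rewrite ?mem_order ?inE ?xT ?yT.
Qed.

(** Otherwise an element of F lies below Y, and it violates its own condition. *)
Lemma blowup_face_bot N Y : blowup_face s N Y -> Y = \bot.
Proof.
move=> /allP bY; apply/eqP; apply/negPn/negP=> /(building_below buildF)[x xF xY].
have /bY/negP[] : x \in rcons s \top.
  rewrite mem_rcons inE mem_order !inE xF andbT; by case: (x == \top).
exact: le_trans xY (leUl _ _).
Qed.

Lemma mem_nested_complex N : (N \in nested_complex F) =
  (N \subset F :\ \top) && blowup_face s N \bot.
Proof.
have kF := kappa_connected buildF connF; have TF := top_building.
apply/imsetP/andP => [[N']|[sNF bN]].
  rewrite inE kF => /and3P[sN'F _ /forallP nN] {N}->.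
  rewrite kF in nN.
  have sND : N' :\ \top \subset F :\ \top by apply: setSD.
  split=> //; apply/allP=> E; rewrite mem_rcons inE mem_order => Es.
  have EF : E \in F by case/orP: Es => [/eqP ->|/setD1P[]].
  apply/negP; rewrite join0x.
  (* The maximal elements of A form an antichain with the same join as A. *)
  pose A := [set x in N' :\ \top | (index x s < index E s)%N].
  have -> : \join_(x in N' :\ \top | (index x s < index E s)%N) x = \join_(x in A) x.
    by apply: eq_bigl => x; rewrite [in RHS]inE.
  have sAN : A \subset N' :\ \top by apply/subsetP=> x; rewrite inE => /andP[].
  have sMA : maxima A \subset A by apply/subsetP=> x /maximaP[].
  rewrite -join_maxima => /(le_join_nested buildF).
  case=> //.
  - apply: subset_trans (subset_trans sMA sAN) (subset_trans sND _).
    exact: subsetDl.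
  - move=> A' sA'A A'gt1.
    have /implyP := nN A'; apply; rewrite A'gt1 (subset_trans sA'A) ?(subset_trans sMA) //=.
    apply/forall_inP=> x /(subsetP sA'A)/maximaP[xA mx].
    apply/forall_inP=> y /(subsetP sA'A)/maximaP[yA my].
    apply/implyP=> xy; rewrite /Order.comparable; apply/norP; split.
      by apply: contra xy => /(mx _ yA) ->.
    by apply: contra xy => /(my _ xA) ->.
  - move=> x /maximaP[]; rewrite inE => /andP[/setD1P[_ xN'] ltx] _ Ex.
    by have := order_le EF (subsetP sN'F _ xN') Ex; rewrite leqNgt ltx.
have TN : \top \notin N by apply: contraTN isT => /(subsetP sNF); rewrite !inE eqxx.
exists (\top |: N); last by rewrite kF setU1K.
rewrite inE; apply/and3P; split.
- by rewrite subUset sub1set TF (subset_trans sNF) ?subsetDl.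
- by rewrite kF sub1set setU11.
apply/forallP=> A; apply/implyP=> /and3P[]; rewrite kF setU1K // => sAN Agt1 acA.
apply/negP=> jF; set E := \join_(x in A) x in jF.
have /(allP bN)/negP[] : E \in rcons s \top.
  by rewrite mem_rcons inE mem_order !inE jF andbT orbN.
rewrite join0x; apply/joinsP=> x xA.
have [xT xF] := setD1P (subsetP sNF _ (subsetP sAN _ xA)).
apply: joins_sup; rewrite (subsetP sAN) //= ltn_neqAle.
have xE : x <= E by apply: joins_sup.
rewrite order_le // andbT; apply: contraTneq acA => idxE.
have xs : x \in s by rewrite mem_order !inE xT.
have {idxE xE} eqxE : x = E.
  have Es : E \in s by rewrite -index_mem -idxE index_mem.
  by rewrite -(nth_index x xs) idxE nth_index.
have /card_gt0P[y] : (0 < #|A :\ x|)%N by move: Agt1; rewrite (cardsD1 x) xA.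
case/setD1P=> yx yA; apply/negP=> /forall_inP/(_ x xA)/forall_inP/(_ y yA).
rewrite eq_sym yx /= => /norP[_]; rewrite eqxE => /negP[].
exact: joins_sup.
Qed.

End NestedComplex.
End Maxima.

(** * Restriction to a set containing all proper faces *)

Section SignVectors.
Variable U : finType.
Variable M : acyclic_om U.
Implicit Types (X Y Z : signed_set U) (H : {set U}).

(** Among the covectors that are positive outside the negative part of X and
    whose negative part is nonempty and contained in that of X, choose one, Y,
    with the smallest negative part.  Eliminating an element between Y and the
    positive covector shrinks the negative part, so the result is nonnegative
    by minimality; its zero set is the required face. *)
Lemma face_below_negative X : X \in covectors M -> X.2 != set0 ->
  exists2 H, is_face M H & (H != set0) && (H \subset X.2).
Proof.
move=> XM X0.
have TM : (ground M, set0) \in covectors M := acyclic_omP M.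
pose P Y := [&& Y \in covectors M, Y.2 != set0, Y.2 \subset X.2 &
  ground M :\: X.2 \subset Y.1].
have PX : P (scomp X (ground M, set0)).
  rewrite /P covector_comp // /scomp /= set0D setU0 X0 subxx /=.
  exact: subsetUr.
case: (arg_minnP (fun Y : signed_set U => #|Y.2|) PX) => Y /and4P[YM Y0 YX XY] minY.
have [_ sY] := covector_signed YM; have [disY _] := covector_signed YM.
have {sY}[sY1 sY2] : Y.1 \subset ground M /\ Y.2 \subset ground M.
  by move: sY; rewrite subUset => /andP.
have [e eY] := set0Pn _ Y0.
have sepY : separation Y (ground M, set0) = Y.2.
  by rewrite /separation /= setI0 set0U; apply/setIidPl.
have := covector_elim YM TM (e := e); rewrite sepY => /(_ eY).
case=> Z [ZM eZ Z1 Z2]; move: Z1 Z2; rewrite /= set0D setU0 setDv => Z1 /eqP.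
rewrite setD_eq0 => Z2.
have posZ x : x \in ground M -> x \notin Y.2 -> x \in Z.1.
  move=> xM xY; have /setP/(_ x) := Z1; rewrite !inE xY /= => ->.
  by rewrite xM orbT.
have {Z2 minY} Z0 : Z.2 = set0.
  apply/eqP; apply/negPn/negP=> Z0; have : P Z.
    rewrite /P ZM Z0 (subset_trans Z2) //=.
    apply/subsetP=> x; rewrite inE => /andP[xX xM]; apply: posZ => //.
    by apply: contra xX; apply: (subsetP YX).
  move/minY; rewrite leqNgt => /negP[]; apply: proper_card; rewrite properE Z2.
  by apply/subsetPn; exists e => //; apply: contra eZ => eZ; rewrite inE eZ orbT.
have [_ sZ] := covector_signed ZM; move: sZ; rewrite Z0 setU0 => sZ.
exists (ground M :\: Z.1).
  rewrite /is_face subsetDl /= setDDr setDv set0U (setIidPr sZ) -Z0.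
  by case: (Z) ZM.
apply/andP; split.
  apply/set0Pn; exists e; rewrite inE (subsetP sY2) // andbT.
  by apply: contra eZ => eZ; rewrite inE eZ.
apply/subsetP=> x /setDP[xM xZ]; apply: (subsetP YX).
by apply: contraNT xZ; apply: posZ.
Qed.

End SignVectors.

Section Restriction.
Variables (U V : finType) (a : V -> U) (D : {set V}) (M : acyclic_om U).
Hypothesis inj_a : {in D &, injective a}.
Hypothesis aDM : a @: D \subset ground M.
Hypothesis D_neq0 : D != set0.
Hypothesis faces_aD : forall H : {set U}, proper_face M H -> H \subset a @: D.

Lemma ground_restrict : ground (restrict a D M) = D.
Proof.
apply/setP=> x; rewrite !inE; apply: andb_idr => xD.
by apply: (subsetP aDM); apply: imset_f.
Qed.

(** A negative part avoiding a(D) would contain a nonempty face, proper because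
    a(D) is not empty, and thus a nonempty subset of a(D). *)
Lemma negative_meets_aD (X : signed_set U) : X \in covectors M -> X.2 != set0 ->
  exists2 x, x \in D & a x \in X.2.
Proof.
move=> XM /(face_below_negative XM)[H fH /andP[/set0Pn[e eH] HX]].
have [eqH|pH] := eqVneq H (ground M).
  have [x xD] := set0Pn _ D_neq0; exists x => //.
  by apply: (subsetP HX); rewrite eqH; apply: (subsetP aDM); apply: imset_f.
have /faces_aD/subsetP/(_ e eH)/imsetP[x xD ex] : proper_face M H.
  by rewrite /proper_face fH.
by exists x; rewrite // -ex; apply: (subsetP HX).
Qed.

Lemma proper_face_restrict (A : {set V}) :
  proper_face (restrict a D M) A = (A \subset D) && proper_face M (a @: A).
Proof.
have mem_im (B : {set V}) x : B \subset D -> x \in D -> (a x \in a @: B) = (x \in B).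
  move=> sBD xD; apply/imsetP/idP => [[y yB /inj_a -> //]|]; last by exists x.
  exact: (subsetP sBD).
rewrite /proper_face {1}/is_face ground_restrict -[LHS]andbA.
apply: andb_id2l => sAD; apply/andP/andP => [[/imsetP[X XM] [X1 X2] neqA]|[fA pA]].
  have X0 : X.2 = set0.
    apply/eqP/negPn/negP=> /(negative_meets_aD XM)[x xD xX].
    by have /setP/(_ x) := X2; rewrite !inE xD xX.
  have [_ sX] := covector_signed XM; rewrite X0 setU0 in sX.
  have mX x : x \in D -> (x \in A) = (a x \notin X.1).
    by move=> xD; have /setP/(_ x) := X1; rewrite !inE xD andbT /= => <-; rewrite negbK.
  have [y yD yA] : exists2 y, y \in D & y \notin A.
    by apply/subsetPn; apply: contra neqA => sDA; rewrite eqEsubset sAD.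
  have fX : is_face M (ground M :\: X.1).
    rewrite /is_face subsetDl /= setDDr setDv set0U (setIidPr sX) -X0.
    by case: (X) XM.
  have neqX : ground M :\: X.1 != ground M.
    apply: contraNneq yA => /setP/(_ (a y)); rewrite inE mX //.
    by rewrite (subsetP aDM) ?imset_f // andbT.
  have eqX : ground M :\: X.1 = a @: A.
    have sXD : ground M :\: X.1 \subset a @: D.
      by apply: faces_aD; rewrite /proper_face fX.
    apply/setP=> u; apply/idP/imsetP => [uX|[x xA ->]].
      have /imsetP[x xD ux] := subsetP sXD _ uX; exists x => //.
      by move: uX; rewrite mX // ux inE => /andP[].
    have xD := subsetP sAD _ xA.
    by rewrite inE -mX // xA (subsetP aDM) ?imset_f.
  by rewrite -eqX fX neqX.
have /andP[_ cA] := fA; split.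
  apply/imsetP; exists (ground M :\: a @: A, set0) => //.
  congr (_, _); apply/setP=> x; rewrite !inE /= ?andbF //.
  case xD: (x \in D); rewrite ?andbF //= mem_im // andbT.
  by rewrite (subsetP aDM) ?imset_f ?andbT.
(* If a(D) were a proper face, the opposite of its covector would be negative
   exactly on the elements outside a(D). *)
apply/eqP=> eqA; rewrite eqA in fA pA cA.
have [||x xD] := @negative_meets_aD (set0, ground M :\: a @: D).
- exact: covectorN cA.
- by rewrite /= setD_eq0; apply: contra pA => sMD; rewrite eqEsubset aDM.
- by rewrite /= inE imset_f.
Qed.

End Restriction.

(** * Faces of the iterated stellar subdivision *)

Section IteratedStellar.
Variables (U : finType) (M : acyclic_om U) (a : face M -> U).
Implicit Types (s : seq (face M)) (B : {set face M}) (G E : face M).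

Lemma proper_faceP (H : {set U}) :
  reflect (exists2 G : face M, G != \top%O & H = G) (proper_face M H).
Proof.
apply: (iffP andP) => [[fH pH]|[G GT ->]]; first by exists (Face fH).
by rewrite faceP.
Qed.

Lemma ground_iterated s M' : iterated_stellar a s M' ->
  [/\ uniq s, {in s &, injective a}, {in s, forall E, a E \notin ground M} &
      ground M' = a @: [set x in s] :|: ground M].
Proof.
elim: s M' => [|E s IHs] M' /=.
  move=> ->; split=> //; apply/setP=> u; rewrite !inE.
  by case: imsetP => // -[x]; rewrite inE.
case=> M1 /IHs[us ja aM gM1] [_ aE gM' _].
move: aE; rewrite gM1 inE negb_or => /andP[aEs aEM].
have aE x : x \in s -> a x != a E.
  by move=> xs; apply: contraNneq aEs => <-; apply: imset_f; rewrite inE.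
split.
- by rewrite us andbT; apply/negP=> /aE; rewrite eqxx.
- move=> x y; rewrite !inE => /orP[/eqP ->|xs] /orP[/eqP ->|ys] //; last exact: ja.
    by move/esym/eqP; rewrite (negPf (aE _ ys)).
  by move/eqP; rewrite (negPf (aE _ xs)).
- by move=> x; rewrite inE => /orP[/eqP ->|/aM].
rewrite gM' gM1 setUA; congr (_ :|: _); apply/setP=> u; rewrite !inE.
apply/orP/imsetP => [[/eqP ->|/imsetP[x]]|[x]].
- by exists E; rewrite // !inE eqxx.
- by rewrite inE => xs ->; exists x; rewrite // !inE xs orbT.
- rewrite !inE => /orP[/eqP ->|xs] ->; first by left.
  by right; apply: imset_f; rewrite inE.
Qed.

(** In a set a(B) u G the parts B and G can be recovered and compared
    separately, because the elements a(B) are new and distinct. *)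
Section NewElements.
Variable s : seq (face M).
Hypothesis inj_a : {in s &, injective a}.
Hypothesis new_a : {in s, forall E, a E \notin ground M}.

Lemma face_ground G : G \subset ground M.
Proof. by case/andP: (faceP G). Qed.

Lemma sub_old_part E B G : B \subset [set x in s] ->
  (E \subset a @: B :|: G) = (E <= G)%O.
Proof.
move=> /subsetP sB; apply/idP/idP => [sE|/subset_trans->//]; last exact: subsetUr.
apply/subsetP=> u uE; have /setUP[/imsetP[x /sB xs ux]|//] := subsetP sE u uE.
rewrite inE in xs; have := new_a xs.
by rewrite -ux (subsetP (face_ground E)).
Qed.

Lemma sub_new_part B B' G : B \subset [set x in s] -> B' \subset [set x in s] ->
  a @: B \subset a @: B' :|: G -> B \subset B'.
Proof.
move=> /subsetP sB /subsetP sB' sBB; apply/subsetP=> x xB.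
have xs := sB _ xB; rewrite inE in xs.
have /setUP[/imsetP[y yB']|] := subsetP sBB _ (imset_f a xB).
  by have := sB' _ yB'; rewrite inE => ys /inj_a ->.
by move/(subsetP (face_ground G)); rewrite (negPf (new_a xs)).
Qed.

End NewElements.

(** By induction on s, matching the two kinds of faces of a stellar subdivision
    with the two cases of [blowup_face_cons].  That a_E may be adjoined to
    a(B) u G is witnessed by some face containing a(B), E and G; since the
    condition is monotone, the witness can be taken to be a(B) u (E v G). *)
Lemma proper_face_iterated s M' : \top%O \notin s -> iterated_stellar a s M' ->
  forall H : {set U}, proper_face M' H <->
    exists B G,
      [/\ B \subset [set x in s], blowup_face s B G & H = a @: B :|: G].
Proof.
elim: s M' => [|E s IHs] M' Ts /=.
  move=> -> H; split=> [/proper_faceP[G GT ->]|[B [G [sB]]]].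
    by exists set0, G; rewrite sub0set blowup_face_nil GT imset0 set0U.
  rewrite blowup_face_nil => GT ->; apply/proper_faceP; exists G => //.
  have -> : B = set0.
    apply/eqP; rewrite -subset0; apply: subset_trans sB _.
    by apply/subsetP=> x; rewrite inE.
  by rewrite imset0 set0U.
case=> M1 it1 st H; have Ts' : \top%O \notin s.
  by move: Ts; rewrite inE negb_or => /andP[].
have [us ja aM _] := @ground_iterated (E :: s) M' (ex_intro2 _ _ M1 it1 st).
have sS B : B \subset [set x in s] -> B \subset [set x in E :: s].
  by move/subset_trans; apply; apply/subsetP=> x; rewrite !inE orbC => ->.
have Es B : B \subset [set x in s] -> E \notin B.
  by move=> sB; have /andP[+ _] := us; apply: contra => /(subsetP sB); rewrite inE.
have {}IHs := IHs M1 Ts' it1.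
case: st => _ _ _ /(_ H) stH; apply: iff_trans stH _; split.
  case=> [[/IHs[B [G [sB bBG ->]]]]|[K []]].
    rewrite (sub_old_part aM _ _ (sS _ sB)) => EG; exists B, G; split=> //; first exact: sS.
    by rewrite blowup_face_cons // EG (negPf (Es _ sB)).
  case/IHs=> B [G [sB bBG ->]]; rewrite (sub_old_part aM _ _ (sS _ sB)) => EG.
  case=> K' /IHs[B' [G' [sB' bBG' ->]]]; rewrite !subUset => /and3P[sE sBB sG] ->.
  rewrite (sub_old_part aM _ _ (sS _ sB')) // in sE.
  rewrite (sub_old_part aM _ _ (sS _ sB')) // in sG.
  exists (E |: B), G; split; last by rewrite imsetU1 setUA.
    rewrite subUset sub1set sS // andbT; by rewrite !inE eqxx.
  rewrite blowup_face_cons // EG setU11 /=.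
  apply: blowup_face_le bBG'; last by rewrite leUx sE sG.
  apply: subset_trans (sub_new_part ja aM (sS _ sB) (sS _ sB') sBB).
  apply/subsetP=> x; rewrite !inE => /andP[/orP[/eqP ->|//]].
  by have /andP[/negPf ->] := us.
case=> B [G [sB]]; rewrite blowup_face_cons // => /andP[EG bBG] ->.
have sBE : B :\ E \subset [set x in s].
  apply/subsetP=> x /setD1P[xE /(subsetP sB)]; by rewrite !inE (negPf xE).
have bE G' : blowup_face s B G' -> blowup_face s (B :\ E) G'.
  by apply: blowup_face_le => //; apply: subset_trans (subsetIl _ _) (subsetDl _ _).
case: (boolP (E \in B)) bBG => EB bBG; last first.
  left; split; last by rewrite (sub_old_part aM _ _ sB).
  apply/IHs; exists B, G; split=> //; apply: subset_trans sBE.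
  by rewrite subsetD1 subxx.
right; exists (a @: (B :\ E) :|: G); split.
- apply/IHs; exists (B :\ E), G; split=> //; apply: blowup_face_le (bE _ bBG) => //.
    exact: subsetIl.
  exact: leUr.
- by rewrite (sub_old_part aM _ _ (sS _ sBE)).
- exists (a @: (B :\ E) :|: (E `|` G)%O).
    by apply/IHs; exists (B :\ E), (E `|` G)%O; split=> //; apply: bE.
  have EG_E : E \subset (E `|` G)%O by apply: (leUl E G).
  have EG_G : G \subset (E `|` G)%O by apply: (leUr G E).
  rewrite !subUset subsetUl (subset_trans EG_E) ?subsetUr //=.
  by rewrite (subset_trans EG_G) ?subsetUr.
by rewrite setUA -imsetU1 setD1K.
Qed.

End IteratedStellar.

Theorem theorem7p2 (U : finType) (M : acyclic_om U) (F : {set face M})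
    (N : acyclic_om (face M)) :
  building_set F -> connected F -> facial_sd F N ->
  nested_complex F = face_semilattice N.
Proof.
move=> buildF connF [a [s [M' [perm_s sorted_s it ->]]]].
have Ts := top_notin_order perm_s.
have eqD : F :\ \top%O = [set x in s].
  by apply/setP=> x; rewrite [in RHS]inE (mem_order perm_s).
have [_ ja aM gM'] := ground_iterated it.
have faces := proper_face_iterated Ts it.
have inj_a : {in F :\ \top%O &, injective a}.
  by rewrite eqD => x y; rewrite !inE; apply: ja.
have aDM : a @: (F :\ \top%O) \subset ground M' by rewrite gM' eqD subsetUl.
have facesD (H : {set U}) : proper_face M' H ->
    exists2 B : {set face M}, B \subset F :\ \top%O &
      blowup_face s B \bot%O /\ H = a @: B.
  case/faces=> B [G [sB bB ->]]; exists B; first by rewrite eqD.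
  by have GB := blowup_face_bot buildF perm_s bB; rewrite GB in bB *; rewrite setU0.
apply/setP=> B; rewrite (mem_nested_complex buildF connF perm_s sorted_s).
rewrite /face_semilattice.
(* When only the top is in F, both sides consist of the empty set alone. *)
have [D0|D0] := eqVneq (F :\ \top%O) set0.
  have gN : ground (restrict a (F :\ \top%O) M') = set0.
    by rewrite /= D0 /pull_set set0I.
  rewrite gN eqxx inE D0 subset0; apply: andb_idr => /eqP ->.
  have -> : s = [::].
    by apply: size0nil; rewrite (perm_size perm_s) -cardE D0 cards0.
  rewrite blowup_face_nil; apply: contraTneq (top_building buildF connF) => <-.
  by case: buildF.
rewrite (ground_restrict aDM) (negPf D0) inE.
rewrite (proper_face_restrict inj_a aDM D0); last first.
  by move=> H /facesD[C sC [_ ->]]; apply: imsetS.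
apply: andb_id2l => sB; apply/idP/idP => [bB|/facesD[C sC [bC eqBC]]].
  by apply/faces; exists B, \bot%O; rewrite -eqD sB bB setU0.
rewrite eqD in sB sC; have -> // : B = C.
by apply/eqP; rewrite eqEsubset; apply/andP; split;
  apply: (sub_new_part (G := \bot%O) ja aM) => //; rewrite eqBC subsetUl.
Qed.
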